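(* Let $M_1$ and $M_2$ be reachable markings of a t-net, and let $R_1\in\mathit{repr}(M_1)$ and $R_2\in\mathit{repr}(M_2)$. If $R_1\sim R_2$ (equivalence of sibling ordered pid-trees), then $M_1\sim M_2$ (state equivalence).
   Context: Process identifiers (pids). $\mathbb{P}=(\mathbb{N}^+)^*$ is the set of finite tuples of positive integers, including $\langle\rangle$, under concatenation; $\langle a_1,\dots,a_n\rangle$ is written $a_1.\cdots.a_n$. For $\pi=\langle a_1,\dots,a_n\rangle$: $\mathit{length}(\pi)=n$; $\mathit{prefix}(\pi)=\langle a_1,\dots,a_{n-1}\rangle$ if $n>0$, else $\langle\rangle$; $\mathit{subpid}(\pi)=\{\pi\}\cup\mathit{subpid}(\mathit{prefix}(\pi))$ if $n>0$, $\emptyset$ if $n=0$. Relations: $\pi\sphericalangle_1\pi'$ iff $\pi'=\pi.a$ for some $a\in\mathbb N^+$; $\pi\sphericalangle\pi'$ iff $\pi'=\pi.a_1.\cdots.a_n$ for some $n\ge1$; $\pi\pitchfork_1\pi'$ iff $\pi=\pi''.i$, $\pi'=\pi''.(i+1)$ with $\pi''\ne\langle\rangle$; $\pi\pitchfork\pi'$ iff $\pi=\pi''.i$, $\pi'=\pi''.j$ with $\pi''\ne\langle\rangle$, $i<j$. $\mathbb P$ is ordered hierarchically: by length, then lexicographically. Coloured Petri nets and t-nets. Fix data values $\mathbb D\supseteq\mathbb N$ (disjoint from $\mathbb P$), variables $\mathbb V$, expressions $\mathbb E\supseteq\mathbb V\cup\mathbb D$; bindings are partial maps $\beta:\mathbb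 V\to\mathbb P\cup\mathbb D$ extended to expressions. A Petri net $(S,T,\ell)$ has finite disjoint places and transitions, place types $\ell(s)=X_1\times\dots\times X_k$ ($X_i\in\{\mathbb P,\mathbb D\}$), guards $\ell(t)\in\mathbb E$, arc labels $\ell(x,y)$ multisets over $\mathbb E$. A marking maps places to multisets of tokens of their type; $M\xrightarrow{t,\beta}M'$ iff $M(s)\ge\beta(\ell(s,t))$, $\beta(\ell(t,s))$ has type $\ell(s)$, $M'(s)=M(s)-\beta(\ell(s,t))+\beta(\ell(t,s))$ for all $s$, and $\beta(\ell(t))$ holds. A t-net additionally has: a unique generator place $s_\eta$ of type $\mathbb P\times\mathbb N$; initial marking with $M_0(s_\eta)=\{\langle\langle1\rangle,0\rangle\}$, other places empty or containing only data; for each $t$, $\ell(s_\eta,t)=\{\langle p_i,c_i\rangle:1\le i\le k\}$ (distinct variables) and $\ell(t,s_\eta)=\{\langle p_i,c_i+n_i\rangle:1\le i\le m\}\cup\{\langle p_i.(c_i+j),0\rangle:1\le i\le k,1\le j\le n_i\}$ ($m\le k$, $n_i\ge0$), $\Pi_t$ being the set of the $p_i.(c_i+j)$; arcs from $s\ne s_\eta$ carry vectors of variables and data values; arcs to $s\ne s_\eta$ carry vectors of expressions over data variables/values and elements of $\Pi_t\cup\{p_1,\dots,p_m\}$; guards are computable Boolean expressions over adjacent-arc variables and data values in which pids from $\Pi_t\cup\{p_1,\dots,p_k\}$ are only compared using $=,\sphericalangle_1,\sphericalangle,\pitchfork_1,\pitchfork$. Reachable markings are reached from $M_0$ by finitely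 many firings. States and state equivalence. For reachable $M$: $\sigma_M$ is the restriction of $M$ to places other than $s_\eta$; $\eta_M=\{\pi\mapsto k:\langle\pi,k\rangle\in M(s_\eta)\}$; $\mathit{next}_M(\pi)=\pi.(\eta_M(\pi)+1)$ for $\pi\in\mathrm{dom}(\eta_M)$; $\mathit{nextpid}_M=\{\mathit{next}_M(\pi):\pi\in\mathrm{dom}(\eta_M)\}$; $\mathit{pid}_M$ is the set of pids occurring in tokens of $M$ in any place (including $s_\eta$). $M\sim_h M'$ iff $h:\mathit{pid}_M\cup\mathit{nextpid}_M\to\mathit{pid}_{M'}\cup\mathit{nextpid}_{M'}$ is a bijection with: (1) $h(\mathrm{dom}(\eta_M))=\mathrm{dom}(\eta_{M'})$; (2) $h(\mathit{next}_M(\pi))=\mathit{next}_{M'}(h(\pi))$ for $\pi\in\mathrm{dom}(\eta_M)$; (3) for $\prec\in\{\sphericalangle_1,\sphericalangle\}$ and $\pi,\pi'\in\mathit{pid}_M$: $\pi\prec\pi'$ iff $h(\pi)\prec h(\pi')$; (4) for $\curlywedge\in\{\pitchfork_1,\pitchfork\}$ and $\pi,\pi'\in\mathit{pid}_M\cup\mathit{nextpid}_M$: $\pi\curlywedge\pi'$ iff $h(\pi)\curlywedge h(\pi')$; (5) $\sigma_{M'}$ is $\sigma_M$ with each pid $\pi$ replaced by $h(\pi)$. $M\sim M'$ iff $M\sim_h M'$ for some $h$. Pid-trees. $\Xi$ is the least set with $\langle M,C\rangle\in\Xi$ for a marking $M$ and $C=\langle\langle a_1,t_1\rangle,\dots,\langle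 a_n,t_n\rangle\rangle$, $t_i\in\Xi$, $a_i\in\mathbb P\setminus\{\langle\rangle\}$, for $i\ne j$: $a_i\ne a_j$, $a_i\notin\mathit{subpid}(a_j)$, $a_j\notin\mathit{subpid}(a_i)$; written $M\xrightarrow{a_1,\dots,a_n}\langle t_1,\dots,t_n\rangle$, root marking $M_t$. Inclusion: $\langle M',\langle\langle a'_i,t'_i\rangle\rangle_{i\le m}\rangle\subseteq\langle M,\langle\langle a_j,t_j\rangle\rangle_{j\le n}\rangle$ iff $M'\le M$ and each $i$ has $j$ with $a'_i=a_j$, $t'_i\subseteq t_j$. Subtrees: $\langle\langle\rangle,t_0\rangle\in\mathit{Trees}(t_0)$ and $\langle a_i.\pi',t\rangle\in\mathit{Trees}(t_0)$ if $\langle\pi',t\rangle\in\mathit{Trees}(t_i)$; $\mathit{pid}(t)=\{\pi:\langle\pi,t'\rangle\in\mathit{Trees}(t)\}$. Path labelled $\pi$ decorated by $M'$: pid-tree $t$ with $\pi\in\mathit{pid}(t)\subseteq\mathit{subpid}(\pi)\cup\{\langle\rangle\}$, $\langle\pi,\langle M',\langle\rangle\rangle\rangle\in\mathit{Trees}(t)$, all other markings empty; ''$R$ contains $\mathit{path}(\pi,M')$'' means such a path is $\subseteq R$; $\mathit{path}(\pi)=\mathit{path}(\pi,\emptyset)$. Relative path of nonempty $\pi\in\mathit{pid}(t)$, $t=M\xrightarrow{a_1,\dots,a_n}\langle t_1,\dots,t_n\rangle$: $\mathit{relpath}(\pi,t)=\langle i\rangle$ if $\pi=a_i$, and $\langle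 i\rangle$ followed by $\mathit{relpath}(\pi',t_i)$ if $\pi=a_i.\pi'$, $\pi'\ne\langle\rangle$; convention $\mathit{relpath}(\langle\rangle,t)=\langle\rangle$. Sibling ordered: $a_1\le\dots\le a_n$ (hierarchically) at every node. Representations. $\mathit{repr}(M)$: sibling ordered pid-trees $R$ built so that for each place $s$ of type $X_1\times\dots\times X_n$ and token $v=\langle x_1,\dots,x_n\rangle\in M(s)$ exactly one rule applies, and $R$ contains nothing beyond what the rules require (tokens with multiplicity): generator rule ($s=s_\eta$, $v=\langle\pi,i\rangle$): $R$ contains $\mathit{path}(\pi)$ and $\mathit{path}(\pi.(i+1))$; shared rule ($X_1=\mathbb D$): $R$ contains $\mathit{path}(\langle\rangle,\{(s,v)\})$ and $\mathit{path}(x_i)$ for every $X_i=\mathbb P$; owned rule ($X_1=\mathbb P$): $R$ contains $\mathit{path}(x_1,\{(s,v)\})$ and $\mathit{path}(x_i)$ for every $X_i=\mathbb P$. Pid-tree equivalence. For sibling ordered $T,T'$: $T\sim_h T'$ iff (1) $h=\{(\pi,\pi'):\pi\in\mathit{pid}(T),\pi'\in\mathit{pid}(T'),\mathit{relpath}(\pi,T)=\mathit{relpath}(\pi',T')\}$ is a bijection $\mathit{pid}(T)\to\mathit{pid}(T')$; (2) for all $\langle\pi,t\rangle\in\mathit{Trees}(T)$, $\langle h(\pi),t'\rangle\in\mathit{Trees}(T')$ with $t=M_t\xrightarrow{a_1,\dots,a_n}\langle\dots\rangle$, $t'=M_{t'}\xrightarrow{a'_1,\dots,a'_{n'}}\langle\dots\rangle$: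 (a) $n=n'$; (b) for each $s\ne s_\eta$, $M_{t'}(s)$ is $M_t(s)$ with every pid $\rho$ replaced by $h(\rho)$; (c) for each $i$, $\mathit{length}(a_i)=\mathit{length}(a'_i)=1$ or both $>1$; (d) for each $1\le i<n$ with $\mathit{prefix}(a_i)=\mathit{prefix}(a_{i+1})$: $\mathit{prefix}(a'_i)=\mathit{prefix}(a'_{i+1})$ and, with $x,y,x',y'$ the last components of $a_i,a_{i+1},a'_i,a'_{i+1}$, either $y-x=y'-x'=1$ or $y-x>1$ and $y'-x'>1$. $T\sim T'$ iff $T\sim_h T'$ for some $h$.
   Formalization: R1 ~ R2 is required in both directions (equality of prefixes in clause (d) becomes an ''iff''), since the one-sided relation is not symmetric and the claim fails for it; guards compare only pids from Π_t and the p_i, which is immaterial as guards only restrict reachability. *)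

(* Defs.v *)
From HB Require Import structures.
From mathcomp Require Import all_boot all_order.
From mathcomp Require Import finmap multiset.
From mathcomp Require Import boolp classical_sets functions.

Set Implicit Arguments.
Unset Strict Implicit.
Unset Printing Implicit Defensive.

Local Open Scope nat_scope.
Local Open Scope mset_scope.

Definition posnat := {n : nat | 0 < n}.

Definition posS (i : nat) : posnat := exist _ i.+1 (ltn0Sn i).

Definition pid := seq posnat.

Definition pprefix (p : pid) : pid := take (size p).-1 p.

(* Unfolds to p, pprefix p, pprefix (pprefix p), ... down to length 1. *)
Definition subpid (p : pid) : seq pid := traject pprefix p (size p).

Definition child1 (p q : pid) : Prop := exists a, q = rcons p a.

Definition desc (p q : pid) : Prop := exists2 w : pid, w <> [::] & q = p ++ w.

Definition sib1 (p q : pid) : Prop := exists (r : pid) (i j : posnat),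
  [/\ r <> [::], p = rcons r i, q = rcons r j & val j = (val i).+1].

Definition sib (p q : pid) : Prop := exists (r : pid) (i j : posnat),
  [/\ r <> [::], p = rcons r i, q = rcons r j & val i < val j].

Definition hle (p q : pid) : bool :=
  (size p < size q)
  || (size p == size q)
     && ((map val p : Order.SeqLexiOrder.Exports.seqlexi nat) <= (map val q))%O.

Inductive pidrel := REq | RChild1 | RDesc | RSib1 | RSib.

Definition pidrel_sem (r : pidrel) : pid -> pid -> Prop :=
  match r with
  | REq => eq | RChild1 => child1 | RDesc => desc | RSib1 => sib1 | RSib => sib
  end.

(* The parameters of the colour domain: the data values that are not natural
   numbers, the variables, and operation symbols denoting arbitrary partial
   operations on data. *)
Record language := Language {
  odata : choiceType;
  var : choiceType;
  op : choiceType;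
  op_sem : op -> seq (nat + odata) -> option (nat + odata)
}.

(* A set of data values containing the naturals is the disjoint sum of the
   naturals and of its other elements. *)
Definition data (L : language) := (nat + odata L)%type.

Definition value (L : language) := (pid + data L)%type.

Definition token (L : language) := seq (value L).

(* NatK is only used for the second component of the generator place. *)
Inductive kind := PidK | DataK | NatK.

Definition has_kind L (x : value L) (k : kind) : bool :=
  match k, x with
  | PidK, inl _ => true
  | DataK, inr _ => true
  | NatK, inr (inl _) => true
  | _, _ => false
  end.

Definition has_type L (v : token L) (ks : seq kind) : bool := all2 (@has_kind L) v ks.

Definition atom (L : language) := (var L + data L)%type.

(* Composite data expressions need no constructor: [op] ranges over arbitrary
   sets of operations, so they are operation symbols themselves. *)
Inductive expr (L : language) :=
| Var of var L
| Val of data L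
| Add of var L & nat               (* c + n *)
| Child of var L & var L & nat     (* p.(c + j) *)
| App of op L & seq (atom L).      (* operation on data *)
Arguments Var {L}.
Arguments Val {L}.
Arguments Add {L}.
Arguments Child {L}.
Arguments App {L}.

Definition expr_code (L : language) :=
  (var L + data L + (var L * nat) + (var L * var L * nat)
   + (op L * seq (atom L)))%type.

Definition expr_encode L (e : expr L) : expr_code L :=
  match e with
  | Var x => inl (inl (inl (inl x)))
  | Val d => inl (inl (inl (inr d)))
  | Add c n => inl (inl (inr (c, n)))
  | Child p c j => inl (inr (p, c, j))
  | App f xs => inr (f, xs)
  end.

Definition expr_decode L (c : expr_code L) : expr L :=
  match c with
  | inl (inl (inl (inl x))) => Var x
  | inl (inl (inl (inr d))) => Val d
  | inl (inl (inr (c, n))) => Add c n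
  | inl (inr (p, c, j)) => Child p c j
  | inr (f, xs) => App f xs
  end.

Lemma expr_encodeK L : cancel (@expr_encode L) (@expr_decode L).
Proof. by case. Qed.

HB.instance Definition _ L := Choice.copy (expr L) (can_type (@expr_encodeK L)).

Definition binding (L : language) := var L -> option (value L).

Fixpoint all_some A (s : seq (option A)) : option (seq A) :=
  if s is o :: s' then obind (fun x => omap (cons x) (all_some s')) o
  else Some [::].

Definition atom_val L (b : binding L) (a : atom L) : option (data L) :=
  match a with
  | inl x => if b x is Some (inr d) then Some d else None
  | inr d => Some d
  end.

Definition eval L (b : binding L) (e : expr L) : option (value L) :=
  match e with
  | Var x => b x
  | Val d => Some (inr d)
  | Add c n =>
      if b c is Some (inr (inl k)) then Some (inr (inl (k + n))) else None
  | Child p c j =>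
      match b p, b c with
      | Some (inl r), Some (inr (inl k)) =>
          omap (fun a : posnat => inl (rcons r a)) (insub (k + j))
      | _, _ => None
      end
  | App f xs =>
      omap inr (obind (@op_sem L f) (all_some [seq atom_val b a | a <- xs]))
  end.

Definition label (L : language) := {mset seq (expr L)}.

Definition eval_label L (b : binding L) (l : label L) : option {mset token L} :=
  omap (@seq_mset _)
    (all_some [seq all_some [seq eval b e | e <- v] | v <- enum_mset l]).

(* Guards: pids are only accessible through the five comparisons. *)
Inductive guard (L : language) :=
| GData of (seq (data L) -> bool) & seq (atom L)
| GCmp of pidrel & expr L & expr L
| GNot of guard L
| GAnd of guard L & guard L.

Fixpoint geval L (b : binding L) (g : guard L) : option bool :=
  match g with
  | GData f xs => omap f (all_some [seq atom_val b a | a <- xs])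
  | GCmp r e1 e2 =>
      match eval b e1, eval b e2 with
      | Some (inl p), Some (inl q) => Some `[< pidrel_sem r p q >]
      | _, _ => None
      end
  | GNot g' => omap negb (geval b g')
  | GAnd g1 g2 => obind (fun c => omap (andb c) (geval b g2)) (geval b g1)
  end.

Record net (L : language) := Net {
  place : finType;
  trans : finType;
  ptype : place -> seq kind;
  tguard : trans -> guard L;
  pre : place -> trans -> label L;     (* arc from the place *)
  post : trans -> place -> label L     (* arc to the place *)
}.

Definition marking L (N : net L) := {ffun place N -> {mset token L}}.

Definition well_typed L (N : net L) (M : marking N) : Prop :=
  forall s v, v \in M s -> has_type v (ptype s).

Definition empty_marking L (N : net L) : marking N := [ffun=> mset0].

Definition le_marking L (N : net L) (M M' : marking N) : bool :=
  [forall s, M s `<=` M' s].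

Definition fires L (N : net L) (M : marking N) (t : trans N) (b : binding L)
    (M' : marking N) : Prop :=
  geval b (tguard t) = Some true /\
  forall s, exists i o : {mset token L},
    [/\ eval_label b (pre s t) = Some i,
        eval_label b (post t s) = Some o,
        i `<=` M s,
        (forall v, v \in o -> has_type v (ptype s)) &
        M' s = (M s `\` i) `+` o].

Definition atom_vars L (a : atom L) : seq (var L) := if a is inl x then [:: x] else [::].

Definition expr_vars L (e : expr L) : seq (var L) :=
  match e with
  | Var x => [:: x]
  | Val _ => [::]
  | Add c _ => [:: c]
  | Child p c _ => [:: p; c]
  | App _ xs => flatten [seq atom_vars a | a <- xs]
  end.

Definition adjacent_var L (N : net L) (t : trans N) (x : var L) : Prop :=
  exists s v e, [/\ (v \in pre s t) || (v \in post t s), e \in v & x \in expr_vars e].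

Definition var_or_data L (e : expr L) : bool :=
  match e with Var _ | Val _ => true | _ => false end.

Definition data_expr L (e : expr L) : bool :=
  match e with Var _ | Val _ | App _ _ => true | _ => false end.

Definition is_pidK (k : kind) : bool := if k is PidK then true else false.

Definition is_natK (k : kind) : bool := if k is NatK then true else false.

(* A variable in a DataK component is a data variable, because the produced
   token must have the type of the place for the transition to fire. *)
Definition out_component L (pids : seq (expr L)) (e : expr L) (k : kind) : bool :=
  if is_pidK k then e \in pids else data_expr e.

Fixpoint guard_ok L (adj : var L -> Prop) (pids : seq (expr L)) (g : guard L) : Prop :=
  match g with
  | GData _ xs => forall a x, a \in xs -> x \in atom_vars a -> adj x
  | GCmp _ e1 e2 => e1 \in pids /\ e2 \in pids
  | GNot g' => guard_ok adj pids g'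
  | GAnd g1 g2 => guard_ok adj pids g1 /\ guard_ok adj pids g2
  end.

(* [gs] lists the triples (p_i, c_i, n_i) for i <= k, and the first [m] of them
   are the ones whose generator is put back. *)
Definition created L (gs : seq (var L * var L * nat)) : seq (expr L) :=
  [seq Child g.1.1 g.1.2 j | g <- gs, j <- iota 1 g.2].

Definition tnet_trans L (N : net L) (gen : place N) (t : trans N) : Prop :=
  exists (gs : seq (var L * var L * nat)) (m : nat),
  [/\ m <= size gs /\ uniq ([seq g.1.1 | g <- gs] ++ [seq g.1.2 | g <- gs]),
      pre gen t = seq_mset [seq [:: Var g.1.1; Var g.1.2] | g <- gs],
      post t gen = seq_mset
        ([seq [:: Var g.1.1; Add g.1.2 g.2] | g <- take m gs]
         ++ [seq [:: e; Val (inl 0)] | e <- created gs]),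
      (forall s, s != gen ->
        (forall v, v \in pre s t -> all (@var_or_data L) v) /\
        (forall v, v \in post t s ->
          all2 (out_component (created gs ++ [seq Var g.1.1 | g <- take m gs]))
               v (ptype s))) &
      guard_ok (adjacent_var t) (created gs ++ [seq Var g.1.1 | g <- gs])
               (tguard t)].

Definition gtoken L (p : pid) (k : nat) : token L := [:: inl p; inr (inl k)].
Arguments gtoken L p k : clear implicits.

Definition is_data L (x : value L) : bool := if x is inr _ then true else false.

Record tnet (L : language) := Tnet {
  tnet_net :> net L;
  gen : place tnet_net;
  init : marking tnet_net;
  ptype_gen : ptype gen = [:: PidK; NatK];
  ptype_other : forall s, s != gen ->
    ptype s <> [::] /\ all (fun k => ~~ is_natK k) (ptype s);
  init_typed : well_typed init;
  init_gen : init gen = [mset gtoken L [:: posS 0] 0];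
  init_other : forall s v, s != gen -> v \in init s -> all (@is_data L) v;
  tnet_transP : forall t, tnet_trans gen t
}.

Inductive reachable L (N : tnet L) : marking N -> Prop :=
| reachable_init : reachable (init N)
| reachable_fire M t b M' : reachable M -> fires M t b M' -> reachable M'.

Definition eta L (N : tnet L) (M : marking N) (p : pid) (k : nat) : Prop :=
  gtoken L p k \in M (gen N).

Definition dom_eta L (N : tnet L) (M : marking N) : set pid :=
  [set p | exists k, eta M p k]%classic.

(* The graph of next_M, defined like eta as a relation: eta_M is a function for
   reachable M. *)
Definition next L (N : tnet L) (M : marking N) (p q : pid) : Prop :=
  exists2 k, eta M p k & q = rcons p (posS k).

Definition nextpids L (N : tnet L) (M : marking N) : set pid :=
  [set q | exists p, next M p q]%classic.

Definition pids L (N : tnet L) (M : marking N) : set pid :=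
  [set p | exists s v, v \in M s /\ inl p \in v]%classic.

Definition rename_value L (h : pid -> pid) (x : value L) : value L :=
  match x with inl p => inl (h p) | inr d => inr d end.

Definition rename L (h : pid -> pid) (m : {mset token L}) : {mset token L} :=
  seq_mset [seq [seq rename_value h x | x <- v] | v <- enum_mset m].

(* [h] is a total function, of which only the restriction to
   [pids M `|` nextpids M] matters. *)
Definition state_equiv_by L (N : tnet L) (h : pid -> pid) (M M' : marking N) : Prop :=
  let dom := (pids M `|` nextpids M)%classic in
  [/\ set_bij dom (pids M' `|` nextpids M')%classic h /\
      (h @` dom_eta M)%classic = dom_eta M',
      (forall p q, next M p q -> next M' (h p) (h q)),
      (forall p q, pids M p -> pids M q ->
         (child1 p q <-> child1 (h p) (h q)) /\ (desc p q <-> desc (h p) (h q))),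
      (forall p q, dom p -> dom q ->
         (sib1 p q <-> sib1 (h p) (h q)) /\ (sib p q <-> sib (h p) (h q))) &
      (forall s, s != gen N -> M' s = rename h (M s))].

Definition state_equiv L (N : tnet L) (M M' : marking N) : Prop :=
  exists h, state_equiv_by h M M'.

Inductive ptree L (N : net L) := Node of marking N & seq (pid * ptree N).
Arguments Node {L N}.

Definition rootm L (N : net L) (t : ptree N) : marking N := let: Node M _ := t in M.

Definition children L (N : net L) (t : ptree N) : seq (pid * ptree N) :=
  let: Node _ C := t in C.

Definition labels L (N : net L) (t : ptree N) : seq pid := [seq c.1 | c <- children t].

Definition incomparable (a b : pid) : bool :=
  [&& a != b, a \notin subpid b & b \notin subpid a].

(* [trees t p u] says that (p, u) belongs to Trees(t). *)
Inductive trees L (N : net L) : ptree N -> pid -> ptree N -> Prop :=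
| trees_root t : trees t [::] t
| trees_child M C i a ti p t :
    onth C i = Some (a, ti) -> trees ti p t -> trees (Node M C) (a ++ p) t.

Definition tpids L (N : net L) (t : ptree N) : set pid :=
  [set p | exists u, trees t p u]%classic.

(* Raw trees are unconstrained; the pid-trees are the ones satisfying [wf_tree]. *)
Definition wf_tree L (N : net L) (t : ptree N) : Prop :=
  forall p u, trees t p u ->
    [/\ well_typed (rootm u),
        all (fun a => a != [::]) (labels u) &
        pairwise incomparable (labels u)].

Definition sibling_ordered L (N : net L) (t : ptree N) : Prop :=
  forall p u, trees t p u -> sorted hle (labels u).

Fixpoint incl L (N : net L) (t' t : ptree N) : bool :=
  let: Node M' C' := t' in
  le_marking M' (rootm t)
  && all (fun c' => has (fun c => (c'.1 == c.1) && incl c'.2 c.2) (children t)) C'.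

Definition is_path L (N : net L) (p : pid) (M' : marking N) (t : ptree N) : Prop :=
  [/\ wf_tree t,
      (forall q, tpids t q -> q \in subpid p \/ q = [::]),
      trees t p (Node M' [::]) &
      (forall q u, trees t q u -> q <> p -> rootm u = empty_marking N)].

Definition contains_path L (N : net L) (R : ptree N) (p : pid) (M' : marking N) : Prop :=
  exists2 t, is_path p M' t & incl t R.

Inductive relpath L (N : net L) : pid -> ptree N -> seq nat -> Prop :=
| relpath_nil t : relpath [::] t [::]
| relpath_cons M C i a ti p r :
    onth C i = Some (a, ti) -> relpath p ti r ->
    relpath (a ++ p) (Node M C) (i.+1 :: r).

(* The token [v] of the place [s], with its multiplicity in [M]. *)
Definition occurrences L (N : net L) (M : marking N) (s : place N) (v : token L) :
    marking N :=
  [ffun s' => if s' == s then msetn (M s v) v else mset0].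

(* [required M p M'] says that some rule, applied to a token of [M], asks for
   path(p, M'). *)
Inductive required L (N : tnet L) (M : marking N) : pid -> marking N -> Prop :=
| required_generator p i :
    gtoken L p i \in M (gen N) -> required M p (empty_marking N)
| required_next p i :
    gtoken L p i \in M (gen N) -> required M (rcons p (posS i)) (empty_marking N)
| required_shared s v ks :
    s != gen N -> ptype s = DataK :: ks -> v \in M s ->
    required M [::] (occurrences M s v)
| required_shared_pid s v ks p :
    s != gen N -> ptype s = DataK :: ks -> v \in M s -> inl p \in v ->
    required M p (empty_marking N)
| required_owned s v ks p w :
    s != gen N -> ptype s = PidK :: ks -> v \in M s -> v = inl p :: w ->
    required M p (occurrences M s v)
| required_owned_pid s v ks p :
    s != gen N -> ptype s = PidK :: ks -> v \in M s -> inl p \in v ->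
    required M p (empty_marking N).

(* The last conjunct says that R contains nothing beyond the required paths: each
   of its nodes lies on one of them, and each token of its markings is required
   there, with that multiplicity. *)
Definition repr L (N : tnet L) (M : marking N) : set (ptree N) :=
  [set R | [/\ wf_tree R, sibling_ordered R,
     (forall p M', required M p M' -> contains_path R p M') &
     (forall p u, trees R p u ->
        (p = [::] \/ exists q M', required M q M' /\ p \in subpid q) /\
        (forall s v, v \in rootm u s ->
           exists2 M', required M p M' & rootm u s v <= M' s v))]]%classic.

(* Truncated subtraction is harmless in [gap1] and [gap_gt1]: their conditions
   fail when [y <= x], as for integers. *)
Definition last_nat (p : pid) : nat := last 0 (map val p).

Definition gap1 (a b : pid) : bool := last_nat b - last_nat a == 1.

Definition gap_gt1 (a b : pid) : bool := 1 < last_nat b - last_nat a.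

Definition tree_equiv_by L (N : tnet L) (h : pid -> pid) (T T' : ptree N) : Prop :=
  [/\ set_bij (tpids T) (tpids T') h,
      (forall p p', tpids T p -> tpids T' p' ->
         (h p = p' <-> exists r, relpath p T r /\ relpath p' T' r)) &
      (forall p t t', trees T p t -> trees T' (h p) t' ->
         let a := nth [::] (labels t) in
         let a' := nth [::] (labels t') in
         let n := size (labels t) in
         [/\ n = size (labels t'),
             (forall s, s != gen N -> rootm t' s = rename h (rootm t s)),
             (forall i, i < n ->
                (size (a i) = 1 /\ size (a' i) = 1) \/
                (1 < size (a i) /\ 1 < size (a' i))) &
             (forall i, i.+1 < n -> pprefix (a i) = pprefix (a i.+1) ->
                pprefix (a' i) = pprefix (a' i.+1) /\
                ((gap1 (a i) (a i.+1) /\ gap1 (a' i) (a' i.+1)) \/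
                 (gap_gt1 (a i) (a i.+1) /\ gap_gt1 (a' i) (a' i.+1))))])].

(* The last clause of [tree_equiv_by] is guarded by the equality of two prefixes
   in T only, so that [exists h, tree_equiv_by h T T'] is not symmetric: T may
   have consecutive edges 1.1 and 2.1 where T' has 1.1 and 1.2, hence siblings
   that T does not have.  As pid-tree equivalence is meant to be an equivalence
   relation, the comparison is required in both directions; all the other clauses
   are symmetric already. *)
Definition tree_equiv L (N : tnet L) (T T' : ptree N) : Prop :=
  (exists h, tree_equiv_by h T T') /\ (exists h, tree_equiv_by h T' T).

(* Main.v *)
(* The bijection [h] of a pid-tree equivalence preserves child indices, hence the
   prefix order between the pids of the trees.  Every pid and next pid of a marking
   labels a node, so [h] preserves descendants, and the lengths of the labels
   identify the children among them.  Siblings hang off the same node by labels with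
   a common prefix, which are contiguous in the sibling order, so the conditions on
   consecutive labels decide the sibling relations.  Each token sits at the node of
   its owner (at the root if it is shared), so [h] carries the tokens of M1 to those
   of M2.  The generator place is not compared by pid-tree equivalence: it is
   recovered because, in a reachable marking, no pid extends a next pid, so that the
   next pids are exactly the nonempty leaves that do not occur in the data tokens. *)
From mathcomp Require Import all_boot all_order.
From mathcomp Require Import finmap multiset.
From mathcomp Require Import boolp classical_sets functions.
From mathcomp Require Import zify.
Require Import Defs.

Set Implicit Arguments.
Unset Strict Implicit.
Unset Printing Implicit Defensive.

Import Order.Theory.
Import Order.SeqLexiOrder.Exports.

Local Open Scope nat_scope.
Local Open Scope mset_scope.

(** * Prefixes, subpids and descendants *)

Lemma prefix_rconsE (T : eqType) (p q : seq T) a :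
  prefix p (rcons q a) = (p == rcons q a) || prefix p q.
Proof.
apply/idP/orP => [/prefixP[s]|[/eqP->|pq]]; first last.
- exact: prefix_trans pq (prefix_rcons _ _).
- exact: prefix_refl.
case/lastP: s => [|s b]; first by rewrite cats0 => ->; left.
by rewrite -rcons_cat => /rcons_inj[-> _]; right; apply: prefix_prefix.
Qed.

Lemma prefix_anti (T : eqType) (p q : seq T) : prefix p q -> prefix q p -> p = q.
Proof.
case/prefixP=> s -> /size_prefix; rewrite size_cat -subn_eq0 addKn size_eq0.
by move/eqP->; rewrite cats0.
Qed.

Lemma prefix_catlE (T : eqType) (s p q : seq T) :
  prefix (s ++ p) (s ++ q) = prefix p q.
Proof. by elim: s => //= x s IH; rewrite eqxx. Qed.

Lemma cat_prefix_total (T : eqType) (a b p q : seq T) :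
  a ++ p = b ++ q -> prefix a b || prefix b a.
Proof.
by elim: a b => [|x a IH] [|y b] //= [-> /IH]; rewrite eqxx.
Qed.

Lemma pprefix_rcons p a : pprefix (rcons p a) = p.
Proof. by rewrite /pprefix size_rcons /= -cats1 take_size_cat. Qed.

Lemma last_nat_rcons p a : last_nat (rcons p a) = val a.
Proof. by rewrite /last_nat map_rcons last_rcons. Qed.

Lemma mem_subpid (q p : pid) : (q \in subpid p) = (q != [::]) && prefix q p.
Proof.
elim/last_ind: p => [|p a IH]; first by rewrite prefixs0 andNb.
rewrite /subpid size_rcons trajectS pprefix_rcons inE -/(subpid p) IH prefix_rconsE.
by case: eqVneq => //= ->; case: (p).
Qed.

Lemma descE (p q : pid) : desc p q <-> prefix p q && (p != q).
Proof.
split=> [[w w0 ->]|/andP[/prefixP[w ->] ne]].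
  rewrite prefix_prefix /=; apply/eqP => e; apply: w0.
  by apply/eqP; rewrite -prefixs0 -(prefix_catlE p) -e cats0 prefix_refl.
by exists w => // w0; move: ne; rewrite w0 cats0 eqxx.
Qed.

(** * The hierarchical order and contiguity of siblings *)

Lemma hle_refl : reflexive hle.
Proof. by move=> p; rewrite /hle eqxx lexx orbT. Qed.

Lemma hle_trans : transitive hle.
Proof.
move=> q p r; rewrite /hle.
case/orP=> [pq|/andP[/eqP pq le_pq]]; case/orP=> [qr|/andP[/eqP qr le_qr]].
- by rewrite (ltn_trans pq qr).
- by rewrite -qr pq.
- by rewrite pq qr.
- by rewrite pq qr eqxx (Order.PreorderTheory.le_trans le_pq le_qr) orbT.
Qed.


Lemma lexi_rcons (w : seq nat) x y :
  ((rcons w x : seqlexi nat) <= rcons w y)%O = (x <= y).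
Proof.
elim: w => [|z w IH] /=; last by rewrite eqhead_lexiE.
by rewrite lexi_cons lexx implybT andbT leEnat.
Qed.

Lemma lexi_between (w s : seq nat) x y : size s = (size w).+1 ->
  ((rcons w x : seqlexi nat) <= s)%O -> ((s : seqlexi nat) <= rcons w y)%O ->
  exists z, s = rcons w z.
Proof.
elim: w s => [|c w IH] [|d s] //=.
  by case: s => // _ _ _; exists d.
case=> size_s; rewrite !lexi_cons !leEnat.
case/andP=> le_cd ge_cd /andP[le_dc ge_dc].
have eq_cd : c = d by apply/eqP; rewrite eqn_leq le_cd.
move: ge_cd ge_dc; rewrite eq_cd leqnn /= => le1 le2.
by have [z ->] := IH s size_s le1 le2; exists z.
Qed.

Lemma hle_rcons p a b : hle (rcons p a) (rcons p b) = (val a <= val b).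
Proof. by rewrite /hle !size_rcons ltnn eqxx /= !map_rcons lexi_rcons. Qed.

(** The two bounds have the same length, which forces the length of [q] and leaves only the
    lexicographic comparison. This is the contiguity of siblings in a sorted list of labels. *)
Lemma hle_between p a b q : hle (rcons p a) q -> hle q (rcons p b) ->
  exists c, q = rcons p c.
Proof.
rewrite /hle !size_rcons.
case/orP=> [lt1|/andP[/eqP eq1 le1]]; case/orP=> [lt2|/andP[/eqP eq2 le2]].
- by move: (ltn_trans lt1 lt2); rewrite ltnn.
- by move: lt1; rewrite eq2 ltnn.
- by move: lt2; rewrite eq1 ltnn.
rewrite !map_rcons in le1 le2.
have size_q : size (map val q) = (size (map val p)).+1 by rewrite !size_map.
have [z] := lexi_between size_q le1 le2.
case/lastP: q {eq1 eq2 le1 le2 size_q} => [|q c]; first by case: (map _ p).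
by rewrite map_rcons => /rcons_inj[/(inj_map val_inj)-> _]; exists c.
Qed.

(* Labels with a common prefix are contiguous in a sibling ordered sequence, so
   that comparing consecutive ones suffices. *)
Lemma gap_transfer (ls ls' : seq pid) :
  sorted hle ls -> uniq ls ->
  (forall k, k.+1 < size ls ->
     pprefix (nth [::] ls k) = pprefix (nth [::] ls k.+1) ->
     pprefix (nth [::] ls' k) = pprefix (nth [::] ls' k.+1) /\
     ((gap1 (nth [::] ls k) (nth [::] ls k.+1)
       /\ gap1 (nth [::] ls' k) (nth [::] ls' k.+1)) \/
      (gap_gt1 (nth [::] ls k) (nth [::] ls k.+1)
       /\ gap_gt1 (nth [::] ls' k) (nth [::] ls' k.+1)))) ->
  forall i j w a b, i < size ls -> j < size ls ->
  nth [::] ls i = rcons w a -> nth [::] ls j = rcons w b -> val a < val b ->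
  [/\ pprefix (nth [::] ls' i) = pprefix (nth [::] ls' j),
      last_nat (nth [::] ls' i) < last_nat (nth [::] ls' j) &
      val b = (val a).+1 ->
      last_nat (nth [::] ls' j) = (last_nat (nth [::] ls' i)).+1].
Proof.
move=> ord_ls uniq_ls step i j w a b lti.
have le_nth := sorted_leq_nth hle_trans hle_refl [::] ord_ls.
move=> ltj eq_i eq_j lt_ab.
have lt_ij : i < j.
  rewrite ltnNge; apply/negP => /(le_nth _ _ ltj lti).
  by rewrite eq_i eq_j hle_rcons leqNgt lt_ab.
(* Induction on the distance [d.+1] between the two positions; [step] settles distance one. *)
have [d eq_d] : exists d, j = i + d.+1 by exists (j - i).-1; lia.
elim: d j b {lt_ij} eq_d ltj eq_j lt_ab => [|d IH] j b -> ltj eq_j lt_ab.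
  rewrite addn1 in ltj eq_j *.
  have [|eq_pre gaps] := step i ltj; first by rewrite eq_i eq_j !pprefix_rcons.
  split=> //.
    by case: gaps => [] [_]; rewrite /gap1 /gap_gt1 => gap; lia.
  case: gaps; rewrite /gap1 /gap_gt1 eq_i eq_j !last_nat_rcons => -[gap gap'] e; lia.
(* [k] is the position just before [j]. Its label lies between the other two, hence also has prefix
   [w]: the induction covers [i] to [k] and [step] covers [k] to [j]. *)
rewrite addnS in ltj eq_j *; set k := i + d.+1 in ltj eq_j *.
have ltk : k < size ls by apply: ltnW.
have [||c eq_k] := @hle_between w a b (nth [::] ls k).
- by rewrite -eq_i; apply: le_nth => //; apply: leq_addr.
- by rewrite -eq_j; apply: le_nth.
have ne_nth u v : u < size ls -> v < size ls -> u != v ->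
    nth [::] ls u <> nth [::] ls v.
  by move=> ltu ltv /eqP ne /eqP; rewrite nth_uniq // => /eqP.
have lt_ac : val a < val c.
  rewrite ltn_neqAle -(hle_rcons w) -eq_i -eq_k; apply/andP; split.
    apply/eqP => /val_inj e; apply: (ne_nth i k) => //; last by rewrite eq_i eq_k e.
    by rewrite /k; lia.
  by apply: le_nth => //; apply: leq_addr.
have lt_cb : val c < val b.
  rewrite ltn_neqAle -(hle_rcons w) -eq_j -eq_k; apply/andP; split.
    apply/eqP => /val_inj e; apply: (ne_nth k k.+1) => //; last by rewrite eq_j eq_k e.
    by lia.
  by apply: le_nth.
have [eq_pre lt_last _] := IH k c erefl ltk eq_k lt_ac.
have [|eq_pre' gaps] := step k ltj; first by rewrite eq_k eq_j !pprefix_rcons.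
(* As [c] lies strictly between [a] and [b], the premise of the third claim is false. *)
split; [by rewrite eq_pre| |by lia].
apply: (ltn_trans lt_last).
by case: gaps => [] [_]; rewrite /gap1 /gap_gt1 => gap; lia.
Qed.

(** * Nodes of pid-trees *)

Section Lookup.
Variables (L : language) (N : net L).
Implicit Types (t u : ptree N) (p q : pid) (r : seq nat).

(** [trees] and [relpath] in one function: a descent along child indices, counted from 0, yields the
    concatenated labels and the subtree reached. *)
Fixpoint lookup t r : option (pid * ptree N) :=
  if r is i :: r' then
    if onth (children t) i is Some (a, ti) then
      omap (fun x => (a ++ x.1, x.2)) (lookup ti r')
    else None
  else Some ([::], t).

Lemma lookup_cat t r1 r2 :
  lookup t (r1 ++ r2) =
  obind (fun x => omap (fun y => (x.1 ++ y.1, y.2)) (lookup x.2 r2)) (lookup t r1).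
Proof.
elim: r1 t => [|i r1 IH] t /=; first by case: (lookup t r2) => [[]|].
case: onth => [[a ti]|] //=; rewrite {}IH.
case: (lookup ti r1) => [[p u]|] //=.
by case: (lookup u r2) => [[q v]|] //=; rewrite catA.
Qed.

Lemma lookup_catS t r1 r2 p1 u1 p2 u2 :
  lookup t r1 = Some (p1, u1) -> lookup u1 r2 = Some (p2, u2) ->
  lookup t (r1 ++ r2) = Some (p1 ++ p2, u2).
Proof. by move=> e1 e2; rewrite lookup_cat e1 /= e2. Qed.

Lemma lookup_catI t r1 r2 q v : lookup t (r1 ++ r2) = Some (q, v) ->
  exists p u q', [/\ lookup t r1 = Some (p, u), lookup u r2 = Some (q', v)
                   & q = p ++ q'].
Proof.
rewrite lookup_cat; case e1: (lookup t r1) => [[p u]|] //=.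
by case e2: (lookup u r2) => [[q' v']|] //= [<- <-]; exists p, u, q'.
Qed.

Lemma treesE t p u : trees t p u <-> exists r, lookup t r = Some (p, u).
Proof.
split=> [|[r]].
  elim=> [{}t|M C i a ti q {}t e _ [r e']]; first by exists [::].
  by exists (i :: r); rewrite /= e e'.
elim: r t p => [|i r IH] [M C] p /=; first by case=> <- <-; exact: trees_root.
case e: (onth C i) => [[a ti]|] //=.
case e': (lookup ti r) => [[q v]|] //= [<- eq_v].
by apply: trees_child e (IH _ _ _); rewrite e' eq_v.
Qed.

Lemma relpathE t p s :
  relpath p t s <-> exists r u, lookup t r = Some (p, u) /\ s = map S r.
Proof.
split=> [|[r]].
  elim=> [{}t|M C i a ti q {}s e _ [r [u [e' ->]]]]; first by exists [::], t.
  by exists (i :: r), u; rewrite /= e e'.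
elim: r t p s => [|i r IH] [M C] p s /= [u].
  by case=> -[<- _] ->; apply: relpath_nil.
case e: (onth C i) => [[a ti]|] //=; last by case.
case e': (lookup ti r) => [[q v]|] /=; last by case.
by case=> -[<- _] ->; apply: relpath_cons e (IH _ _ _ _); exists v.
Qed.

Lemma tpidsE t p : tpids t p <-> exists r u, lookup t r = Some (p, u).
Proof.
by split=> [[u /treesE[r e]]|[r [u e]]]; [exists r, u | exists u; apply/treesE; exists r].
Qed.

Lemma tpids_nil t : tpids t [::].
Proof. by exists t; apply: trees_root. Qed.

Lemma wf_lookup t r p u : wf_tree t -> lookup t r = Some (p, u) -> wf_tree u.
Proof.
move=> wf e q v /treesE[r' e']; apply: (wf (p ++ q)).
by apply/treesE; exists (r ++ r'); apply: lookup_catS e e'.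
Qed.

Lemma onth_labels t i a ti :
  onth (children t) i = Some (a, ti) -> i < size (labels t) /\ nth [::] (labels t) i = a.
Proof.
move=> e; have lti : i < size (children t) by rewrite -onthTE e.
rewrite size_map; split=> //.
by rewrite (nth_map ([::], t)) // (onth_nth _ _ _ _ e).
Qed.

Lemma label_neq0 t i : wf_tree t -> i < size (labels t) -> nth [::] (labels t) i != [::].
Proof.
move=> /(_ _ _ (trees_root t))[_ /allP ne0 _] lti.
by apply: ne0; apply: mem_nth.
Qed.

(** As [subpid] collects the nonempty prefixes and labels are nonempty, incomparability rules out
    any prefix relation between labels at distinct positions. *)
Lemma label_inj t i j : wf_tree t -> i < size (labels t) -> j < size (labels t) ->
  prefix (nth [::] (labels t) i) (nth [::] (labels t) j) -> i = j.
Proof.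
move=> wf; have [_ _ /(pairwiseP [::]) inc] := wf _ _ (trees_root t).
move=> lti ltj pre; case: (ltngtP i j) => // [lt|gt].
  have /and3P[ne + _] := inc _ _ lti ltj lt.
  by rewrite mem_subpid pre label_neq0.
have /and3P[ne _ +] := inc _ _ ltj lti gt.
by rewrite mem_subpid pre label_neq0.
Qed.

Lemma uniq_labels t : wf_tree t -> uniq (labels t).
Proof.
move=> wf; apply/(uniqP [::]) => i j lti ltj e.
by apply: (label_inj wf) => //; rewrite e prefix_refl.
Qed.

(** Paths that part at a node continue with two labels of which neither is a prefix of the other, so
    the pids part there as well. The prefix order thus depends on the index paths alone, which an
    equivalence preserves. *)
Lemma lookup_prefix t r1 r2 p1 u1 p2 u2 : wf_tree t ->
  lookup t r1 = Some (p1, u1) -> lookup t r2 = Some (p2, u2) ->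
  prefix p1 p2 = prefix r1 r2.
Proof.
elim: r1 r2 t p1 p2 => [|i r1 IH] [|j r2] t p1 p2 wf /=.
- by move=> [<- _] [<- _].
- by move=> [<- _] _; rewrite !prefix0s.
- case ei: onth => [[a ti]|] //= + [<- _].
  case: lookup => [[q v]|] //= [<- _].
  have [lti <-] := onth_labels ei.
  by move: (label_neq0 wf lti); case: nth.
case ei: onth => [[a ti]|] //=; case e1: lookup => [[q1 v1]|] //= [<- eq1].
case ej: onth => [[b tj]|] //=; case e2: lookup => [[q2 v2]|] //= [<- eq2].
have [lti eq_a] := onth_labels ei; have [ltj eq_b] := onth_labels ej.
have [eq_ij|ne_ij] := eqVneq i j; last first.
  apply/negP => /prefixP[w]; rewrite -catA => /esym/cat_prefix_total.
  rewrite -eq_a -eq_b; case/orP => /label_inj; move/eqP: ne_ij => ne_ij.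
    by move/(_ wf lti ltj).
  by move/(_ wf ltj lti)/esym.
move: ej; rewrite -eq_ij ei => -[eq_ab eq_t].
rewrite -eq_ab prefix_catlE; rewrite -eq_t eq2 in e2; rewrite eq1 in e1.
apply: (IH _ ti _ _ _ e1 e2).
by apply: (@wf_lookup t [:: i] a) => //=; rewrite ei /= cats0.
Qed.

Lemma lookup_inj t r1 r2 p u1 u2 : wf_tree t ->
  lookup t r1 = Some (p, u1) -> lookup t r2 = Some (p, u2) -> r1 = r2.
Proof.
move=> wf e1 e2; apply: prefix_anti.
  by rewrite -(lookup_prefix wf e1 e2) prefix_refl.
by rewrite -(lookup_prefix wf e2 e1) prefix_refl.
Qed.

Lemma trees_inj t p u v : wf_tree t -> trees t p u -> trees t p v -> u = v.
Proof.
move=> wf /treesE[r e] /treesE[r' e'].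
by move: (e'); rewrite -(lookup_inj wf e e') e => -[].
Qed.

Lemma lookup_single t r a v : wf_tree t -> lookup t r = Some ([:: a], v) ->
  exists i, [/\ r = [:: i], i < size (labels t) & nth [::] (labels t) i = [:: a]].
Proof.
case: r => [|i r] wf //=; case e: onth => [[b ti]|] //=.
case e': lookup => [[q w]|] //= [eq_a eq_v].
have [lti eq_b] := onth_labels e; have := label_neq0 wf lti.
rewrite eq_b; case: b eq_a eq_b e => [|c b] // [-> eq_a] eq_b e _.
have [b0 q0] : b = [::] /\ q = [::] by case: (b) eq_a.
exists i; split=> //; last by rewrite eq_b b0.
congr (_ :: _); apply: (@lookup_inj ti r [::] [::] w ti) => //.
  by apply: (@wf_lookup t [:: i] (a :: b)) => //=; rewrite e /= cats0.
by rewrite e' q0.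
Qed.

Lemma lookup_rcons t r i p u : lookup t (rcons r i) = Some (p, u) ->
  exists q v, [/\ lookup t r = Some (q, v), i < size (labels v)
                & p = q ++ nth [::] (labels v) i].
Proof.
rewrite -cats1 => /lookup_catI[q [v [q' [e e' ->]]]]; exists q, v; split=> //.
  by move: e' => /=; case ei: onth => [[a ti]|] //= _; case: (onth_labels ei).
by move: e' => /=; case ei: onth => [[a ti]|] //= [<- _];
  case: (onth_labels ei) => _ ->; rewrite cats0.
Qed.

(* The subtree carrying [s.x] hangs off the longest proper prefix of [s.x] in
   the tree, which depends on [s] only. *)
Lemma lookup_siblings t s x y rx ry ux uy : wf_tree t ->
  lookup t rx = Some (rcons s x, ux) -> lookup t ry = Some (rcons s y, uy) ->
  exists r i j p u w, [/\ lookup t r = Some (p, u) /\ s = p ++ w,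
    rx = rcons r i, ry = rcons r j,
    i < size (labels u) /\ nth [::] (labels u) i = rcons w x &
    j < size (labels u) /\ nth [::] (labels u) j = rcons w y].
Proof.
move=> wf; case/lastP: rx => [|r i]; first by case; case: (s).
move=> ex; case/lastP: ry => [|r' j]; first by case; case: (s).
move=> ey; have [p [u [e lti eq_x]]] := lookup_rcons ex.
have [p' [u' [e' ltj eq_y]]] := lookup_rcons ey.
have label_rcons (v : ptree N) k q z : wf_tree v -> k < size (labels v) ->
    rcons s z = q ++ nth [::] (labels v) k ->
    exists w, nth [::] (labels v) k = rcons w z /\ s = q ++ w.
  move=> wfv ltk.
  case/lastP: (nth _ _ _) (label_neq0 wfv ltk) => // w z' _.
  by rewrite -rcons_cat => /rcons_inj[-> ->]; exists w.
have [w [eq_i eq_s]] := label_rcons _ _ _ _ (wf_lookup wf e) lti eq_x.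
have [w' [eq_j eq_s']] := label_rcons _ _ _ _ (wf_lookup wf e') ltj eq_y.
(* A node whose pid is a prefix of [s] is an ancestor of the node of [rcons s z], and a proper one
   since its pid is shorter; hence it lies at or above the parent. *)
have sub_prefix rz z v k : lookup t (rcons rz k) = Some (rcons s z, v) ->
    forall r0 p0 u0 w0, lookup t r0 = Some (p0, u0) -> s = p0 ++ w0 -> prefix r0 rz.
  move=> ez r0 p0 u0 w0 e0 eq_s0.
  have : prefix r0 (rcons rz k).
    by rewrite -(lookup_prefix wf e0 ez) eq_s0 rcons_cat prefix_prefix.
  rewrite prefix_rconsE => /orP[/eqP eq_r|] //.
  move: e0; rewrite eq_r ez => -[/(congr1 size)]; rewrite eq_s0 rcons_cat size_cat size_rcons.
  by lia.
have eq_r : r = r'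
  by apply: prefix_anti; [apply: sub_prefix ey _ _ _ _ e eq_s
                         | apply: sub_prefix ex _ _ _ _ e' eq_s'].
move: e' eq_s'; rewrite -eq_r e => -[eq_p eq_u]; rewrite -eq_p eq_s.
move/eqP; rewrite eqseq_cat // eqxx => /eqP eq_w.
by exists r, i, j, p, u, w; split=> //; rewrite eq_u eq_w.
Qed.

End Lookup.

(** * Pid-tree equivalence *)

Section TreeEquiv.
Variables (L : language) (N : tnet L) (h : pid -> pid) (T T' : ptree N).
Hypotheses (wfT : wf_tree T) (wfT' : wf_tree T').
Hypotheses (ordT : sibling_ordered T) (equivT : tree_equiv_by h T T').

Lemma equiv_tpids p : tpids T p -> tpids T' (h p).
Proof. by case: equivT => -[hT _ _] _ _; apply: hT. Qed.

Lemma equiv_inj p q : tpids T p -> tpids T q -> h p = h q -> p = q.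
Proof. by case: equivT => -[_ hI _] _ _ Tp Tq; apply: hI; rewrite inE. Qed.

(** A node and its image have the same relative path, and a pid determines its path. [relpath]
    numbers children from 1 and [lookup] from 0, whence the injectivity of [map S]. *)
Lemma equiv_lookup r p u : lookup T r = Some (p, u) ->
  exists u', lookup T' r = Some (h p, u').
Proof.
move=> e; have Tp : tpids T p by apply/tpidsE; exists r, u.
case: equivT => _ /(_ p (h p) Tp (equiv_tpids Tp)) [+ _] _.
case=> // s [/relpathE[r1 [u1 [e1 ->]]] /relpathE[r2 [u2 [e2 eq_r]]]].
move: e1; rewrite (inj_map succn_inj eq_r) => e1.
by exists u2; rewrite (lookup_inj wfT e e1).
Qed.

Lemma equiv_nil : h [::] = [::].
Proof. by have [u [<-]] := @equiv_lookup [::] [::] T erefl. Qed.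

Lemma equiv_prefix p q : tpids T p -> tpids T q -> prefix (h p) (h q) = prefix p q.
Proof.
move=> /tpidsE[r [u e]] /tpidsE[s [v f]].
have [u' e'] := equiv_lookup e; have [v' f'] := equiv_lookup f.
by rewrite (lookup_prefix wfT e f) (lookup_prefix wfT' e' f').
Qed.

Lemma equiv_desc p q : tpids T p -> tpids T q -> desc p q <-> desc (h p) (h q).
Proof.
move=> Tp Tq; rewrite !descE equiv_prefix //.
suff -> : (p != q) = (h p != h q) by [].
by apply/idP/idP; [apply: contra_neq => /equiv_inj-> | apply: contra_neq => ->].
Qed.

(** A child cannot be reached through several nonempty labels, so it hangs off its parent by one
    edge of length one; the condition on label lengths carries this to the image edge. *)
Lemma equiv_child1 p q : tpids T p -> tpids T q -> child1 p q -> child1 (h p) (h q).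
Proof.
move=> Tp Tq [a eq_q]; move: (Tp) (Tq) => /tpidsE[r [u e]] /tpidsE[s [v f]].
have : prefix r s by rewrite -(lookup_prefix wfT e f) eq_q prefix_rcons.
case/prefixP=> w eq_s; move: f; rewrite eq_s lookup_cat e /=.
case ew: lookup => [[b v']|] //= [eq_b eq_v].
have {}eq_b : b = [:: a].
  by move/eqP: eq_b; rewrite eq_q -cats1 eqseq_cat // eqxx => /eqP.
rewrite eq_b in ew; have wfu := wf_lookup wfT e.
have [i [eq_w lti nth_i]] := lookup_single wfu ew.
have [u' e'] := equiv_lookup e.
have f : lookup T (r ++ [:: i]) = Some (q, v').
  by rewrite -eq_w eq_q -cats1; apply: lookup_catS e ew.
have [v'' ] := equiv_lookup f; rewrite cats1 => /lookup_rcons[p' [u'' []]].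
rewrite e' => -[<- <-] _ ->.
case: equivT => _ _ /(_ p u u') /= [].
- by apply/treesE; exists r.
- by apply/treesE; exists r.
move=> _ _ /(_ i lti) size_i _; case: size_i; rewrite nth_i //= => -[] // _.
by case: nth => [|c []] // _; exists c; rewrite cats1.
Qed.

(** Both siblings hang off one node by labels with a common prefix, to which [gap_transfer] applies.
    The statement serves [sib] and [sib1] at once. *)
Lemma equiv_sib_gap s x y : s <> [::] ->
  tpids T (rcons s x) -> tpids T (rcons s y) -> val x < val y ->
  exists s' x' y', [/\ s' <> [::], h (rcons s x) = rcons s' x',
    h (rcons s y) = rcons s' y', val x' < val y'
    & val y = (val x).+1 -> val y' = (val x').+1].
Proof.
move=> s0 /tpidsE[rx [ux ex]] /tpidsE[ry [uy ey]] lt_xy.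
have [r [i [j [p [u [w [[e eq_s] eq_rx eq_ry [lti eq_i] [ltj eq_j]]]]]]]] :=
  lookup_siblings wfT ex ey.
have [u' e'] := equiv_lookup e.
have [vx] := equiv_lookup ex; have [vy] := equiv_lookup ey; rewrite eq_rx eq_ry.
move=> /lookup_rcons[py [uy' []]]; rewrite e' => -[<- <-] ltj' ->.
move=> /lookup_rcons[px [ux' []]]; rewrite e' => -[<- <-] lti' ->.
have wfu := wf_lookup wfT e; have wfu' := wf_lookup wfT' e'.
have Tu : trees T p u by apply/treesE; exists r.
have Tu' : trees T' (h p) u' by apply/treesE; exists r.
case: equivT => _ _ /(_ p u u' Tu Tu') /= [eq_size _ sizes gaps].
have [] := gap_transfer (ordT Tu) (uniq_labels wfu) gaps lti ltj eq_i eq_j lt_xy.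
have ai0 := label_neq0 wfu' lti'; have aj0 := label_neq0 wfu' ltj'.
have := sizes i lti; rewrite eq_i size_rcons.
case/lastP: (nth _ _ i) ai0 => // wi xi _; case/lastP: (nth _ _ j) aj0 => // wj xj _.
rewrite !pprefix_rcons !last_nat_rcons size_rcons => size_w eq_w lt_x gap_x.
exists (h p ++ wi), xi, xj; split=> //; rewrite ?eq_w ?rcons_cat //.
(* Were the image prefix empty, so would be [h p] and [wi]; then [p] is empty by injectivity, and
   the label lengths make [w], hence [s], empty. *)
rewrite -eq_w; case eq_p : (h p) => [|c hp] // wi0.
have p0 : p = [::].
  apply: equiv_inj; rewrite ?equiv_nil //; last exact: tpids_nil.
  by apply/tpidsE; exists r, u.
by apply: s0; rewrite eq_s p0 /= in wi0 *; apply: size0nil; move: size_w; rewrite wi0 /=; lia.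
Qed.

Lemma equiv_sib p q : tpids T p -> tpids T q -> sib p q -> sib (h p) (h q).
Proof.
move=> Tp Tq [s [x [y [s0 eq_p eq_q lt_xy]]]]; rewrite eq_p eq_q in Tp Tq *.
by have [s' [x' [y' []]]] := equiv_sib_gap s0 Tp Tq lt_xy; exists s', x', y'.
Qed.

Lemma equiv_sib1 p q : tpids T p -> tpids T q -> sib1 p q -> sib1 (h p) (h q).
Proof.
move=> Tp Tq [s [x [y [s0 eq_p eq_q eq_xy]]]]; rewrite eq_p eq_q in Tp Tq *.
have [|s' [x' [y' [? ? ? _ ?]]]] := equiv_sib_gap s0 Tp Tq; first by rewrite eq_xy.
by exists s', x', y'; split; auto.
Qed.

End TreeEquiv.

(** Both maps match nodes by relative path. Being mutually inverse, they turn each one-way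
    preservation result into an equivalence. *)
Lemma equiv_cancel (L : language) (N : tnet L) (h h' : pid -> pid) (T T' : ptree N) p :
  tree_equiv_by h T T' -> tree_equiv_by h' T' T -> tpids T p -> h' (h p) = p.
Proof.
move=> eqh eqh' Tp; have Thp := equiv_tpids eqh Tp.
case: eqh eqh' => _ /(_ _ _ Tp Thp) [/(_ erefl)[r [r1 r2]] _] _.
by case=> _ /(_ _ _ Thp Tp) [_ +] _; apply; exists r.
Qed.

(** * Freshness of next pids in reachable markings *)

Lemma all_someE (A : Type) (s : seq (option A)) l :
  all_some s = Some l <-> s = map Some l.
Proof.
split; last by move->; elim: l => //= x l ->.
by elim: s l => [|[x|] s IH] //= [|y l] //=; case e: all_some => [l'|] //= [<- <-]; rewrite (IH l').
Qed.

Lemma mem_seq_mset (K : choiceType) (s : seq K) x : (x \in seq_mset s) = (x \in s).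
Proof. by rewrite in_mset mset_seqE -has_count has_pred1. Qed.

Lemma perm_enum_msetD (K : choiceType) (s : seq K) (B : {mset K}) :
  perm_eq (seq_mset s `+` B) (s ++ B).
Proof.
by apply/allP => x _ /=; rewrite count_cat !count_mem_mset msetE2 mset_seqE.
Qed.

Lemma uniq_map_inj (T U : eqType) (f : T -> U) s :
  uniq (map f s) -> {in s &, injective f}.
Proof.
elim: s => //= z s IH /andP[s'z us] x y; rewrite !inE.
case/predU1P=> [->|sx]; case/predU1P=> [->|sy] // e; last exact: IH e.
  by move: s'z; rewrite e map_f.
by move: s'z; rewrite -e map_f.
Qed.

Section Firing.
Variable L : language.
Implicit Types (b : binding L) (v : token L) (p q : pid).

Definition eval_tuple b (v : seq (expr L)) : option (token L) :=
  all_some [seq eval b e | e <- v].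

(** [eval_label] enumerates the multiset in an order of its own; a permutation brings the evaluated
    tokens back to the order of [s]. *)
Lemma eval_label_seq b (s : seq (seq (expr L))) i :
  eval_label b (seq_mset s) = Some i ->
  exists2 l, map (eval_tuple b) s = map Some l & i = seq_mset l.
Proof.
rewrite /eval_label; case e: all_some => [l0|] //= [<-].
move/all_someE: e; rewrite -/(eval_tuple b) => e.
have perm_s := perm_map (eval_tuple b) (perm_eq_seq_mset s).
have all_s : all isSome (map (eval_tuple b) s).
  by rewrite -(perm_all _ perm_s) e all_map; apply/allP.
have e' : map (eval_tuple b) s = map Some (pmap (eval_tuple b) s).
  rewrite pmapS_filter; congr map; apply/esym/all_filterP.
  by move: all_s; rewrite all_map.
exists (pmap (eval_tuple b) s) => //; apply/eq_seq_msetP.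
apply: (@perm_map_inj _ _ Some); first by move=> x y [].
by rewrite -e -e'.
Qed.

Lemma eval_label_mem b l i v : eval_label b l = Some i -> v \in i ->
  exists2 ev, ev \in l & eval_tuple b ev = Some v.
Proof.
rewrite -{1}[l]seq_mset_id => /eval_label_seq[s e ->]; rewrite mem_seq_mset => sv.
have : Some v \in map Some s by apply: map_f.
by rewrite -e => /mapP[ev l_ev ->]; exists ev.
Qed.

(** A pid fits only a component of kind [PidK], where [out_component] demands an expression of
    [P]. *)
Lemma out_component_pid b P ev ks v q :
  all2 (out_component P) ev ks -> has_type v ks -> eval_tuple b ev = Some v ->
  inl q \in v -> exists2 e, e \in P & eval b e = Some (inl q).
Proof.
move=> + + /all_someE; elim: ev ks v => [|e ev IH] [|k ks] [|x v] //=.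
move=> /andP[out_e out_ev] /andP[kx tv] [e_x e_v]; rewrite inE.
case/orP=> [/eqP eq_x|]; last exact: IH out_ev tv e_v.
by exists e; [move: out_e kx; rewrite -eq_x; case: k | rewrite e_x eq_x].
Qed.

(* A triple (p, c, n) stands for a generator token (p, c) consumed by a firing
   that creates the n pids p.(c+1), ..., p.(c+n). *)
Definition newpids (I : seq (pid * nat * nat)) : seq pid :=
  [seq rcons g.1.1 (posS (g.1.2 + j.-1)) | g <- I, j <- iota 1 g.2].

Lemma newpidsP I q : q \in newpids I ->
  exists2 g, g \in I & exists2 a, q = rcons g.1.1 a & g.1.2 < val a <= g.1.2 + g.2.
Proof.
case/allpairsPdep=> g [j [Ig]]; rewrite mem_iota => /andP[j0 lt_j] ->.
exists g => //; exists (posS (g.1.2 + j.-1)) => //=.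
by rewrite ltnS leq_addr -addnS prednK // leq_add2l -ltnS.
Qed.

Definition consumed (I : seq (pid * nat * nat)) : seq (token L) :=
  [seq gtoken L g.1.1 g.1.2 | g <- I].

Definition produced m (I : seq (pid * nat * nat)) : seq (token L) :=
  [seq gtoken L g.1.1 (g.1.2 + g.2) | g <- take m I] ++
  [seq gtoken L p 0 | p <- newpids I].

Variable N : tnet L.
Implicit Types (M : marking N) (s : place N).

Lemma gen_token M v : well_typed M -> v \in M (gen N) -> exists p k, v = gtoken L p k.
Proof.
move=> tM /tM; rewrite ptype_gen /has_type.
by case: v => [|[p|?] [|[?|[k|?]] [|? ?]]] //= _; exists p, k.
Qed.

(** The typing of generator tokens forces each [p_i] to be bound to a pid and each [c_i] to a
    number, which gives the triples of [I]. Pids output elsewhere come from created expressions or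
    from consumed generators. *)
Lemma fires_gen M t b M' : well_typed M -> fires M t b M' ->
  exists I m, [/\ seq_mset (consumed I) `<=` M (gen N),
    M' (gen N) = (M (gen N) `\` seq_mset (consumed I)) `+` seq_mset (produced m I) &
    forall s v q, s != gen N -> v \in M' s -> inl q \in v ->
      pids M q \/ q \in newpids I].
Proof.
move=> tM [_ fire]; have [gs [m [_ pre_gen post_gen other _]]] := tnet_transP t.
(* The defaults [[::]] and [0] are never reached on [gs], as [bound] shows. *)
pose P (g : var L * var L * nat) := if b g.1.1 is Some (inl p) then p else [::].
pose C (g : var L * var L * nat) := if b g.1.2 is Some (inr (inl k)) then k else 0.
have [i [o [ev_i ev_o sub_i _ M'gen]]] := fire (gen N).
rewrite pre_gen in ev_i; rewrite post_gen in ev_o.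
have [li ev_li eq_i] := eval_label_seq ev_i.
have [lo ev_lo eq_o] := eval_label_seq ev_o.
have bound g : g \in gs -> b g.1.1 = Some (inl (P g)) /\ b g.1.2 = Some (inr (inl (C g))).
  move=> gs_g; have : Some [:: inl (P g); inr (inl (C g))] = eval_tuple b [:: Var g.1.1; Var g.1.2].
    have : eval_tuple b [:: Var g.1.1; Var g.1.2] \in map Some li.
      by rewrite -ev_li -map_comp; apply/mapP; exists g.
    case/mapP=> v li_v; rewrite /eval_tuple /P /C => /[dup] + ->.
    have : v \in M (gen N) by apply: (msubset_subset sub_i); rewrite eq_i mem_seq_mset.
    case/(gen_token tM)=> p [k ->] /=.
    by case: (b g.1.1) => //= x; case: (b g.1.2) => //= y [-> ->].
  by rewrite /eval_tuple /=; case: (b g.1.1) => //= x; case: (b g.1.2) => //= y [-> ->].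
pose I := [seq (P g, C g, g.2) | g <- gs].
have eq_li : li = consumed I.
  apply: (inj_map (@Some_inj _)); rewrite -ev_li /consumed /I -!map_comp.
  by apply/eq_in_map => g /bound[/= e1 e2]; rewrite /eval_tuple /= e1 e2.
have eval_created : [seq eval b e | e <- created gs] = [seq Some (inl p) | p <- newpids I].
  rewrite /created /newpids /I allpairs_mapl !map_allpairs.
  apply/eq_in_allpairs_dep => g /bound[/= e1 e2] j; rewrite mem_iota => /andP[j0 _].
  rewrite e1 e2 /=; case: insubP => [a _ eq_a|]; last by rewrite addn_gt0 j0 orbT.
  by congr (Some (inl (rcons _ _))); apply: val_inj => /=; rewrite eq_a; lia.
have eq_lo : lo = produced m I.
  apply: (inj_map (@Some_inj _)); rewrite -ev_lo /produced !map_cat; congr (_ ++ _).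
    rewrite /I -map_take -!map_comp; apply/eq_in_map => g /mem_take/bound[/= e1 e2].
    by rewrite /eval_tuple /= e1 e2.
  transitivity [seq omap (fun x => [:: x; inr (inl 0)]) z | z <- map (eval b) (created gs)].
    by rewrite -!map_comp; apply: eq_map => e /=; rewrite /eval_tuple /=; case: eval.
  by rewrite eval_created -!map_comp.
exists I, m; rewrite -eq_li -eq_lo -eq_i -eq_o; split=> // s v q ne_s.
have [i' [o' [_ ev_o' _ to ->]]] := fire s; rewrite in_msetD in_msetB.
case/orP=> [Mv|o'v] vq.
  by left; exists s, v; split=> //; rewrite in_mset (leq_ltn_trans _ Mv).
have [ev post_ev ev_v] := eval_label_mem ev_o' o'v.
have [_ /(_ _ post_ev) out_ev] := other s ne_s.
have [e] := out_component_pid out_ev (to _ o'v) ev_v vq.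
rewrite mem_cat => /orP[cr_e|/mapP[g /mem_take gs_g ->]] ev_e.
  right; have : eval b e \in [seq Some (inl p) | p <- newpids I] by rewrite -eval_created map_f.
  by rewrite ev_e => /mapP[p ? [->]].
left; exists (gen N), (gtoken L (P g) (C g)); split.
  apply: (msubset_subset sub_i); rewrite eq_i mem_seq_mset eq_li /consumed /I -map_comp.
  by apply/mapP; exists g.
by move: ev_e => /=; have [-> _] := bound g gs_g; move=> [->]; rewrite mem_head.
Qed.

(** The node where a representation places a data token: shared tokens start with data, and the
    default [[::]] is the pid of the root. *)
Definition owner v : pid := if v is inl p :: _ then p else [::].

Lemma eta_pids M p k : eta M p k -> pids M p.
Proof. by move=> Mp; exists (gen N), (gtoken L p k); rewrite mem_head. Qed.

Lemma reachable_typed M : reachable M -> well_typed M.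
Proof.
elim=> [|{}M t b M' _ tM [_ fire] s v]; first exact: init_typed.
have [i [o [_ _ _ to ->]]] := fire s; rewrite in_msetD in_msetB.
by case/orP=> [Mv|/to//]; apply: tM; rewrite in_mset (leq_ltn_trans _ Mv).
Qed.

Lemma uniq_newpids I : uniq [seq g.1.1 | g <- I] -> uniq (newpids I).
Proof.
move=> uI; apply: allpairs_uniq_dep => [|g _|]; [exact: map_uniq uI|exact: iota_uniq|].
move=> [g j] [g' j'] /allpairsPdep[x [y [Ix +]]] e /allpairsPdep[x' [y' [Ix' +]]] e'.
case: e e' => -> -> [-> ->] /=; rewrite !mem_iota => /andP[y0 _] /andP[y0' _].
move=> /rcons_inj[/(uniq_map_inj uI Ix Ix')-> /addnI eq_y].
by rewrite -(prednK y0) -(prednK y0') eq_y.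
Qed.

(* The counter of a generator bounds the children that it has created so far. *)
Definition fresh M : Prop := forall p k q a w,
  eta M p k -> pids M q -> q = p ++ a :: w -> val a <= k.

(** Uniqueness of generators is carried along with freshness: otherwise a second token for the same
    pid could keep an old counter while the first one creates children. *)
Lemma fresh_fires M t b M' : well_typed M ->
  uniq [seq owner v | v <- M (gen N)] -> fresh M -> fires M t b M' ->
  uniq [seq owner v | v <- M' (gen N)] /\ fresh M'.
Proof.
move=> tM uM frM /(fires_gen tM)[I [m [sub eq_M' other]]].
set rest : {mset token L} := _ `\` _ in eq_M'.
have perm_M : perm_eq (M (gen N)) (consumed I ++ rest).
  by rewrite -{1}(msetBDKC sub) -/rest perm_enum_msetD.
have perm_M' : perm_eq (M' (gen N)) (produced m I ++ rest).
  by rewrite eq_M' msetDC perm_enum_msetD.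
have map_consumed : [seq owner v | v <- consumed I] = [seq g.1.1 | g <- I].
  by rewrite -map_comp.
have := uM; rewrite (perm_uniq (perm_map owner perm_M)) map_cat map_consumed.
rewrite cat_uniq => /and3P[uI disj u_rest].
have restM v : v \in rest -> v \in M (gen N).
  by rewrite (perm_mem perm_M) mem_cat => ->; rewrite orbT.
have eta_I g : g \in I -> eta M g.1.1 g.1.2.
  by move=> Ig; rewrite /eta (perm_mem perm_M) mem_cat; apply/orP; left; apply: map_f.
have pids_I g : g \in I -> pids M g.1.1 by move/eta_I/eta_pids.
have rest_owner v : v \in rest -> owner v \notin [seq g.1.1 | g <- I].
  by move=> rv; apply: contra disj => Io; apply/hasP; exists (owner v); rewrite ?map_f.
have pids_owner v : v \in rest -> pids M (owner v).
  move/restM=> Mv; have [p [k eq_v]] := gen_token tM Mv.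
  by rewrite eq_v in Mv *; apply: eta_pids Mv.
(* The last component of a new pid exceeds the counter of its generator, so by freshness no pid of
   [M] equals or extends it. *)
have new_pids q w : q \in newpids I -> ~ pids M (q ++ w).
  case/newpidsP=> g Ig [a -> /andP[lt_a _]] Mq.
  by have := frM _ _ _ _ _ (eta_I g Ig) Mq (cat_rcons _ _ _); rewrite leqNgt lt_a.
have pids_new q : pids M q -> q \notin newpids I.
  by move=> Mq; apply/negP => /(new_pids q [::]); rewrite cats0.
have memM' v : v \in M' (gen N) -> [\/ v \in rest,
    exists2 g, g \in I & v = gtoken L g.1.1 (g.1.2 + g.2) |
    exists2 p, p \in newpids I & v = gtoken L p 0].
  rewrite (perm_mem perm_M') !mem_cat -orbA => /or3P[/mapP[g /mem_take Ig ->]|/mapP[p Ip ->]|->].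
  - by constructor 2; exists g.
  - by constructor 3; exists p.
  - by constructor 1.
have pidsM' q : pids M' q -> pids M q \/ q \in newpids I.
  case=> s [v []]; have [->|ne_s] := eqVneq s (gen N); last exact: other.
  case/memM'=> [/restM Mv vq|[g Ig ->]|[p Ip ->]]; first by left; exists (gen N), v.
    by rewrite !inE orbF => /eqP[->]; left; apply: pids_I.
  by rewrite !inE orbF => /eqP[->]; right.
split.
  rewrite (perm_uniq (perm_map owner perm_M')) /produced !map_cat -!map_comp.
  rewrite (@eq_map _ _ (owner \o _) (fun g => g.1.1)) // (@eq_map _ _ (owner \o _) id) // map_id.
  rewrite !cat_uniq u_rest uniq_newpids // andbT /= -andbA; apply/and3P; split.
  - by rewrite map_take take_uniq.
  - apply/hasPn => q Iq; apply: contraL Iq => /mapP[g /mem_take Ig ->].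
    by apply/pids_new/pids_I.
  - rewrite andbT; apply/hasPn => q /mapP[v rv ->].
    rewrite /= mem_cat negb_or pids_new ?andbT; last exact: pids_owner.
    by apply: contra (rest_owner v rv); rewrite map_take => /mem_take.
(* The generator is untouched, put back or new, and [q] is old or new. For a new [q], an empty [w]
   makes [p] its creator; otherwise the parent of [q], a pid of [M], still extends [p] through
   [a]. *)
move=> p k q a w /memM' + /pidsM' +.
case=> [r_pk|[g Ig [-> ->]]|[p' + [-> _]]].
- have Mpk := restM _ r_pk; case=> [Mq|]; first exact: frM Mpk Mq.
  case/newpidsP=> g Ig [x -> _]; case/lastP: w => [|w z].
    rewrite cats1 => /rcons_inj[eq_p _]; case/negP: (rest_owner _ r_pk).
    by apply/mapP; exists g.
  rewrite -rcons_cons -rcons_cat => /rcons_inj[eq_g _].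
  exact: frM Mpk (pids_I _ Ig) eq_g.
- case=> [Mq|]; first by move/(frM _ _ _ _ _ (eta_I _ Ig) Mq) => /leq_trans; apply; apply: leq_addr.
  case/newpidsP=> g' Ig' [x -> /andP[_ le_x]]; case/lastP: w => [|w z].
    by rewrite cats1 => /rcons_inj[/(uniq_map_inj uI Ig' Ig) <- <-].
  rewrite -rcons_cons -rcons_cat => /rcons_inj[eq_g _].
  by apply: leq_trans (frM _ _ _ _ _ (eta_I _ Ig) (pids_I _ Ig') eq_g) (leq_addr _ _).
- move=> Ip' [Mq eq_q|]; first by case: (new_pids _ (a :: w) Ip'); rewrite -eq_q.
  case/newpidsP=> g Ig [x -> _]; case/lastP: w => [|w z].
    by rewrite cats1 => /rcons_inj[eq_g _]; move: (pids_new _ (pids_I _ Ig)); rewrite eq_g Ip'.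
  rewrite -rcons_cons -rcons_cat => /rcons_inj[eq_g _].
  by case: (new_pids _ (a :: w) Ip'); rewrite -eq_g; apply: pids_I.
Qed.

Lemma reachable_fresh M : reachable M -> fresh M.
Proof.
move=> rM; suff [] : uniq [seq owner v | v <- M (gen N)] /\ fresh M by [].
elim: rM => [|{}M t b M' /reachable_typed tM [uM frM]]; last exact: fresh_fires.
rewrite /fresh /eta init_gen enum_msetn; split=> // p k q a w.
rewrite in_mset1 => /eqP[-> _] [s [v [Mv vq]]] eq_q; exfalso.
have [eq_s|ne_s] := eqVneq s (gen N); last first.
  by have /allP/(_ _ vq) := init_other ne_s Mv.
move: Mv vq; rewrite eq_s init_gen in_mset1 => /eqP->.
by rewrite !inE orbF => /eqP[]; rewrite eq_q.
Qed.

End Firing.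

(** * Representations *)

Lemma has_onth (T : Type) (a : pred T) s :
  has a s -> exists i x, onth s i = Some x /\ a x.
Proof.
elim: s => //= x s IH /orP[ax|/IH[i [y ?]]]; first by exists 0, x.
by exists i.+1, y.
Qed.

Lemma incl_trees (L : language) (N : net L) (t R : ptree N) p u :
  incl t R -> trees t p u ->
  exists u', trees R p u' /\ le_marking (rootm u) (rootm u').
Proof.
move=> + tu; elim: tu R => [{u}t|M C i a ti q {}u e _ IH] [M' C'] /=.
  by case: t => M C /= /andP[? _]; exists (Node M' C'); split=> //; apply: trees_root.
case/andP=> _; elim: C i e => [|c C IHC] [|i] //=; last first.
  by move=> e /andP[_]; apply: IHC e.
case=> -> /andP[+ _].
move=> hasC'; have [j [[b w] [e /andP[/eqP /= -> /IH[u' [tu' le]]]]]] := has_onth hasC'.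
by exists u'; split=> //; apply: trees_child e tu'.
Qed.

(** Injectivity is asked on the tokens of [m] only, since a pid renaming is controlled only on the
    pids of a tree. *)
Lemma rename_count (L : language) (f : pid -> pid) (m : {mset token L}) v :
  (forall w, w \in m ->
    map (rename_value f) w = map (rename_value f) v -> w = v) ->
  rename f m (map (rename_value f) v) = m v.
Proof.
move=> inj_f; rewrite mset_seqE count_map -count_mem_mset.
apply: eq_in_count => w mw /=; apply/eqP/eqP => [|->//]; exact: inj_f.
Qed.

Lemma owner_rename (L : language) (f : pid -> pid) (v : token L) : f [::] = [::] ->
  owner (map (rename_value f) v) = f (owner v).
Proof. by case: v => [|[p|d] v]. Qed.

Section Repr.
Variables (L : language) (N : tnet L) (M : marking N) (R : ptree N).
Hypotheses (tM : well_typed M) (frM : fresh M) (reprR : repr M R).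

(* The pids of sigma_M. *)
Definition held (X : marking N) p : Prop :=
  exists s v, [/\ s != gen N, v \in X s & inl p \in v].

Lemma ptype_cases s : s != gen N ->
  exists ks, ptype s = PidK :: ks \/ ptype s = DataK :: ks.
Proof.
move=> /ptype_other[]; case: (ptype s) => [//|[] ks] //= _ _; exists ks; by [left|right].
Qed.

Lemma repr_required p X : required M p X ->
  exists u, trees R p u /\ le_marking X (rootm u).
Proof.
case: reprR => _ _ /(_ p X) + _ => /[apply] -[t [_ _ tp _] tR].
exact: incl_trees tR tp.
Qed.

Lemma repr_held p : held M p -> exists X, required M p X.
Proof.
case=> s [v [ne_s Mv vp]]; have [ks [eq_s|eq_s]] := ptype_cases ne_s.
  by exists (empty_marking N); apply: required_owned_pid eq_s Mv vp.
by exists (empty_marking N); apply: required_shared_pid eq_s Mv vp.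
Qed.

Lemma pidsE p : pids M p <-> held M p \/ dom_eta M p.
Proof.
split=> [[s [v [Mv vp]]]|[[s [v [_ Mv vp]]]|[k Mp]]].
- have [eq_s|ne_s] := eqVneq s (gen N); last by left; exists s, v.
  right; move: Mv vp; rewrite eq_s => Mv; have [q [k eq_v]] := gen_token tM Mv.
  by move: Mv; rewrite eq_v !inE orbF => Mv /eqP[->]; exists k.
- by exists s, v.
- exact: eta_pids Mp.
Qed.

Lemma pids_tpids p : pids M p -> tpids R p.
Proof.
case/pidsE=> [/repr_held[X /repr_required[u [Rp _]]]|[k Mp]]; first by exists u.
have [u [Rp _]] := repr_required (required_generator Mp); by exists u.
Qed.

Lemma nextpids_tpids p : nextpids M p -> tpids R p.
Proof.
case=> q [k Mq ->]; have [u [Rp _]] := repr_required (required_next Mq); by exists u.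
Qed.

Lemma required_cases p X : required M p X ->
  [\/ p = [::], held M p, dom_eta M p | nextpids M p].
Proof.
case=> {p X} [p i Mp|p i Mp|s v ks _ _ _
  |s v ks p s0 _ Mv vp|s v ks p w s0 _ Mv eq_v|s v ks p s0 _ Mv vp].
- by constructor 3; exists i.
- by constructor 4; exists p, i.
- by constructor 1.
- by constructor 2; exists s, v.
- by constructor 2; exists s, v; rewrite eq_v mem_head -eq_v.
- by constructor 2; exists s, v.
Qed.

(** Only the node of its owner can receive a token; under the shared rule the type makes the first
    component data, so that the owner is [[::]]. *)
Lemma required_le p X s v : required M p X ->
  X s v <= if owner v == p then M s v else 0.
Proof.
have occ s' w q : owner w = q ->
    occurrences M s' w s v <= if owner v == q then M s v else 0.
  rewrite ffunE => eq_q; have [->|_] := eqVneq s s'; last by rewrite mset0E.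
  by rewrite msetnE; case: eqP => [->|//]; rewrite eq_q eqxx.
case=> {p X} [p i _|p i _|s' w ks _ eq_s Mw
  |s' w ks p _ _ _ _|s' w ks p z _ _ _ eq_w|s' w ks p _ _ _ _].
- by rewrite ffunE mset0E.
- by rewrite ffunE mset0E.
- by apply: occ; move: (tM Mw); rewrite eq_s; case: (w) => [|[]].
- by rewrite ffunE mset0E.
- by apply: occ; rewrite eq_w.
- by rewrite ffunE mset0E.
Qed.

(* A place is either owned or shared, and a shared token has owner [::], so that
   both rules put the token at the node of its owner. *)
Lemma repr_rootm p u s v : trees R p u -> s != gen N ->
  rootm u s v = if owner v == p then M s v else 0.
Proof.
move=> Rp ne_s; case: (reprR) => wfR _ _ only; apply/eqP; rewrite eqn_leq; apply/andP; split.
  have [|] := boolP (v \in rootm u s); last by rewrite -mset_eq0 => /eqP->.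
  have [_ /[apply] -[X req_X le_X]] := only p u Rp.
  exact: leq_trans le_X (required_le s v req_X).
case: eqP => // eq_p; have [|] := boolP (v \in M s); last by rewrite -mset_eq0 => /eqP->.
move=> Mv; suff req : required M p (occurrences M s v).
  have [u' [Rp' /forallP/(_ s)/msubsetP/(_ v)]] := repr_required req.
  by rewrite (trees_inj wfR Rp Rp') ffunE eqxx msetnE eqxx.
have [ks [eq_s|eq_s]] := ptype_cases ne_s; have := tM Mv; rewrite eq_s /has_type;
  move: eq_p; case eq_v: (v) => [|[q|d] w] //= eq_p _; rewrite -eq_v -eq_p.
  exact: required_owned ne_s eq_s Mv eq_v.
exact: required_shared ne_s eq_s Mv.
Qed.

Lemma owner_tpids s v : s != gen N -> v \in M s -> tpids R (owner v).
Proof.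
move=> ne_s Mv; case eq_v: (v) => [|[q|d] w] /=; try exact: tpids_nil.
by apply: pids_tpids; exists s, v; rewrite Mv eq_v mem_head.
Qed.

(** By freshness a next pid is an unheld leaf. Conversely, a nonempty leaf ends a required path; if
    unheld, it is a generator or a next pid, and a generator has its own next pid below it. *)
Lemma nextpidsE q : nextpids M q <->
  [/\ tpids R q, q <> [::], ~ held M q & forall x, tpids R x -> ~ desc q x].
Proof.
split=> [next_q|[Rq q0 not_held leaf]].
  have Rq := nextpids_tpids next_q; case: next_q => p [k Mp eq_q].
  have not_pid w : ~ pids M (q ++ w).
    rewrite eq_q cat_rcons => Mq.
    by have := frM Mp Mq erefl; rewrite ltnn.
  split=> //; first by rewrite eq_q; case: (p).
    by move=> Mq; apply: (not_pid [::]); rewrite cats0 pidsE; left.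
  case: (reprR) => _ _ _ only x [u Rx] [w w0 eq_x].
  have [[x0|[y [X [req_y x_y]]]] _] := only x u Rx.
    by move: x0; rewrite eq_x eq_q; case: (p).
  move: x_y; rewrite mem_subpid eq_x => /andP[_ /prefixP[z]]; rewrite -catA => eq_y.
  have [y0|Mq|Mq|[p' [k' Mp' eq_y']]] := required_cases req_y.
  - by move: eq_y; rewrite y0 eq_q; case: (p).
  - by apply: (not_pid (w ++ z)); rewrite -eq_y pidsE; left.
  - by apply: (not_pid (w ++ z)); rewrite -eq_y pidsE; right.
  (* A next pid strictly below [q] would have its generator at or below [q], which [not_pid]
     excludes. *)
  move: eq_y; rewrite eq_y'; case/lastP: w w0 eq_x => // w a _ _.
  case/lastP: z => [|z b]; rewrite ?cats0 -!rcons_cat => /rcons_inj[eq_p' _].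
    by apply: (not_pid w); rewrite -eq_p'; apply: eta_pids Mp'.
  by apply: (not_pid (rcons w a ++ z)); rewrite -eq_p'; apply: eta_pids Mp'.
case: (reprR) => _ _ _ only; case: Rq => u Rq.
have [[//|[y [X [req_y q_y]]]] _] := only q u Rq; move: q_y; rewrite mem_subpid => /andP[_ q_y].
have [v [Ry _]] := repr_required req_y.
have eq_y : q = y.
  apply/eqP/negPn/negP => ne; apply: (leaf y); first by exists v.
  by rewrite descE q_y.
rewrite -eq_y in req_y; case: (required_cases req_y) => // -[k Mq].
case: (leaf (rcons q (posS k))); first by apply: nextpids_tpids; exists q, k.
by exists [:: posS k] => //; rewrite cats1.
Qed.

Lemma next_child1 p q : next M p q <-> nextpids M q /\ child1 p q.
Proof.
split=> [[k Mp eq_q]|[[p' [k Mp' eq_q']] [a eq_q]]].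
  by split; [exists p, k | exists (posS k)].
by move: eq_q'; rewrite eq_q => /rcons_inj[-> ->]; exists k.
Qed.

End Repr.

(** * Transport of data tokens along a pid-tree equivalence *)

Section StateEquiv.
Variables (L : language) (N : tnet L) (h h' : pid -> pid).
Variables (M1 M2 : marking N) (R1 R2 : ptree N).
Hypotheses (tM1 : well_typed M1) (tM2 : well_typed M2).
Hypotheses (repr1 : repr M1 R1) (repr2 : repr M2 R2).
Hypotheses (equiv12 : tree_equiv_by h R1 R2) (equiv21 : tree_equiv_by h' R2 R1).

Let wf1 : wf_tree R1. Proof. by case: repr1. Qed.
Let wf2 : wf_tree R2. Proof. by case: repr2. Qed.

Lemma rename_cancel (v : token L) : (forall p, inl p \in v -> tpids R1 p) ->
  map (rename_value h') (map (rename_value h) v) = v.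
Proof.
move=> Rv; rewrite -map_comp -[RHS]map_id; apply/eq_in_map => -[p|d] //= vp.
by rewrite (equiv_cancel equiv12 equiv21 (Rv p vp)).
Qed.

Lemma state_pids_tpids (s : place N) (v : token L) p :
  v \in M1 s -> inl p \in v -> tpids R1 p.
Proof. by move=> Mv vp; apply: (pids_tpids tM1 repr1); exists s, v. Qed.

(** The count of [v] is read at the node of its owner. The image of that node is the node of the
    owner of the renamed token, and the two node markings agree up to renaming. *)
Lemma state_rename s v : s != gen N -> v \in M1 s ->
  M2 s (map (rename_value h) v) = M1 s v.
Proof.
move=> ne_s Mv; have [u Ru] := owner_tpids tM1 repr1 ne_s Mv.
have [u' Ru'] : tpids R2 (h (owner v)) by apply: equiv_tpids equiv12 _ _; exists u.
have rootmE w : rootm u s w = if owner w == owner v then M1 s w else 0.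
  exact: (repr_rootm tM1 repr1 w Ru ne_s).
have := repr_rootm tM2 repr2 (map (rename_value h) v) Ru' ne_s.
rewrite owner_rename ?(equiv_nil wf1 equiv12) // eqxx => <-.
have [_ _ /(_ _ _ _ Ru Ru') [_ /(_ s ne_s) -> _ _]] := equiv12.
(* Tokens of [M1] with the same renaming coincide, as [h'] undoes [h] on their pids. *)
rewrite rename_count ?rootmE ?eqxx // => w; rewrite in_mset rootmE.
case: eqP => // _; rewrite -in_mset => Mw eq_wv.
rewrite -(rename_cancel (fun p => state_pids_tpids Mw)) eq_wv.
exact: rename_cancel (fun p => state_pids_tpids Mv).
Qed.

Lemma state_held p : held M1 p -> held M2 (h p).
Proof.
case=> s [v [ne_s Mv vp]]; exists s, (map (rename_value h) v); split=> //.
  by rewrite in_mset state_rename // -in_mset.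
by apply/mapP; exists (inl p).
Qed.

End StateEquiv.

(** * Transport of generators and next pids *)

Section NextEquiv.
Variables (L : language) (N : tnet L) (h h' : pid -> pid).
Variables (M1 M2 : marking N) (R1 R2 : ptree N).
Hypotheses (tM1 : well_typed M1) (tM2 : well_typed M2).
Hypotheses (frM1 : fresh M1) (frM2 : fresh M2).
Hypotheses (repr1 : repr M1 R1) (repr2 : repr M2 R2).
Hypotheses (equiv12 : tree_equiv_by h R1 R2) (equiv21 : tree_equiv_by h' R2 R1).

Let wf1 : wf_tree R1. Proof. by case: repr1. Qed.
Let wf2 : wf_tree R2. Proof. by case: repr2. Qed.

(** All conditions of [nextpidsE] survive [h]: a held image would give a held [q] through [h'], and
    every node of [R2] is the image of a node of [R1]. *)
Lemma state_nextpids q : nextpids M1 q -> nextpids M2 (h q).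
Proof.
move=> /(nextpidsE tM1 frM1 repr1)[Rq q0 not_held leaf]; apply/(nextpidsE tM2 frM2 repr2).
have hK := equiv_cancel equiv12 equiv21.
split; first exact: (equiv_tpids equiv12 Rq).
- move=> hq0; apply: q0; apply: (equiv_inj equiv12) => //; first exact: tpids_nil.
  by rewrite (equiv_nil wf1 equiv12).
- by move/(state_held tM2 tM1 repr2 repr1 equiv21 equiv12); rewrite hK.
move=> x Rx; rewrite -(equiv_cancel equiv21 equiv12 Rx).
have Rx' := equiv_tpids equiv21 Rx.
by rewrite -(equiv_desc wf1 wf2 equiv12 Rq Rx'); apply: leaf.
Qed.

Lemma state_next p q : next M1 p q -> next M2 (h p) (h q).
Proof.
case/next_child1=> next_q; have [r [k Mr eq_q]] := next_q.
case=> a eq_q'; have eq_r : r = p by move: eq_q; rewrite eq_q' => /rcons_inj[].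
apply/next_child1; split; first exact: state_nextpids.
apply: (equiv_child1 wf1 equiv12); last by exists a.
  by rewrite -eq_r; apply: (pids_tpids tM1 repr1); apply: eta_pids Mr.
exact: (nextpids_tpids repr1 next_q).
Qed.

(** A generator is recognised by its next pid, whose transport supplies the counter in [M2]. *)
Lemma state_dom_eta p : dom_eta M1 p -> dom_eta M2 (h p).
Proof.
case=> k Mp; have [|k' ?] := @state_next p (rcons p (posS k)); first by exists k.
by exists k'.
Qed.

Lemma state_pids p : pids M1 p -> pids M2 (h p).
Proof.
rewrite (pidsE tM1) (pidsE tM2) => -[Mp|/state_dom_eta]; last by right.
by left; apply: (state_held tM1 tM2 repr1 repr2 equiv12 equiv21).
Qed.

Lemma state_all_pids p :
  (pids M1 `|` nextpids M1)%classic p -> (pids M2 `|` nextpids M2)%classic (h p).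
Proof. by case=> [/state_pids|/state_nextpids]; [left | right]. Qed.

Lemma all_pids_tpids p : (pids M1 `|` nextpids M1)%classic p -> tpids R1 p.
Proof. by case=> [/(pids_tpids tM1 repr1)|/(nextpids_tpids repr1)]. Qed.

End NextEquiv.

Theorem theorem2 (L : language) (N : tnet L) (M1 M2 : marking N)
  (hM1 : reachable M1) (hM2 : reachable M2)
  (R1 R2 : ptree N) (hR1 : repr M1 R1) (hR2 : repr M2 R2) :
  tree_equiv R1 R2 -> state_equiv M1 M2.
Proof.
move=> [[h eq12] [h' eq21]]; exists h.
have [t1 t2] := (reachable_typed hM1, reachable_typed hM2).
have [f1 f2] := (reachable_fresh hM1, reachable_fresh hM2).
have [wf1 ord1 _ _] := hR1; have [wf2 ord2 _ _] := hR2.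
have hK := equiv_cancel eq12 eq21; have h'K := equiv_cancel eq21 eq12.
have all1 := all_pids_tpids t1 hR1; have all2 := all_pids_tpids t2 hR2.
split.
- split; first split.
  + by move=> p; apply: (state_all_pids t1 t2 f1 f2 hR1 hR2 eq12 eq21).
  + by move=> p q; rewrite !inE => /all1 Rp /all1 Rq; apply: (equiv_inj eq12).
  + move=> p Mp; exists (h' p); last by rewrite h'K //; apply: all2.
    exact: (state_all_pids t2 t1 f2 f1 hR2 hR1 eq21 eq12 Mp).
  apply/seteqP; split=> [_ [p Mp <-]|p Mp].
    exact: (state_dom_eta t1 t2 f1 f2 hR1 hR2 eq12 eq21 Mp).
  exists (h' p); first exact: (state_dom_eta t2 t1 f2 f1 hR2 hR1 eq21 eq12 Mp).
  by rewrite h'K //; apply: all2; left; apply/(pidsE t2); right.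
- by move=> p q; apply: (state_next t1 t2 f1 f2 hR1 hR2 eq12 eq21).
- move=> p q /(pids_tpids t1 hR1) Rp /(pids_tpids t1 hR1) Rq.
  split; last exact: (equiv_desc wf1 wf2 eq12 Rp Rq).
  split; first exact: (equiv_child1 wf1 eq12 Rp Rq).
  (* The converse is the same fact for [h'], applied to the images. *)
  have := equiv_child1 wf2 eq21 (equiv_tpids eq12 Rp) (equiv_tpids eq12 Rq).
  by rewrite !hK.
- move=> p q /all1 Rp /all1 Rq.
  have [Rhp Rhq] := (equiv_tpids eq12 Rp, equiv_tpids eq12 Rq).
  split; split; [exact: (equiv_sib1 wf1 wf2 ord1 eq12 Rp Rq) |
    | exact: (equiv_sib wf1 wf2 ord1 eq12 Rp Rq) |].
    by have := equiv_sib1 wf2 wf1 ord2 eq21 Rhp Rhq; rewrite !hK.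
  by have := equiv_sib wf2 wf1 ord2 eq21 Rhp Rhq; rewrite !hK.
move=> s ne_s; apply/msetP => v.
have ren12 := state_rename t1 t2 hR1 hR2 eq12 eq21 ne_s.
have ren21 := state_rename t2 t1 hR2 hR1 eq21 eq12 ne_s.
have tp1 := state_pids_tpids t1 hR1; have tp2 := state_pids_tpids t2 hR2.
have cancel1 w (Mw : w \in M1 s) := rename_cancel eq12 eq21 (fun p => tp1 s w p Mw).
have cancel2 w (Mw : w \in M2 s) := rename_cancel eq21 eq12 (fun p => tp2 s w p Mw).
(* A token of [M2] is the renaming of its preimage under [h], with the same count. A token absent
   from [M2] is no renaming of a token of [M1], so both counts vanish. *)
have [Mv|] := boolP (v \in M2 s).
  have Mv' : map (rename_value h') v \in M1 s by rewrite in_mset ren21 // -in_mset.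
  rewrite -(cancel2 v Mv) ren12 // rename_count // => w Mw eq_w.
  by rewrite -(cancel1 w Mw) eq_w cancel1.
rewrite -mset_eq0 => /[dup] + /eqP->; apply: contraTeq; rewrite eq_sym mset_neq0.
rewrite mem_seq_mset => /mapP[w Mw ->].
by rewrite ren12 // mset_neq0.
Qed.
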